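(* Let $\mathcal{P}=(P_1,P_2,\ldots,P_n,\ldots)$ be the sequence of paths, $P_n$ being the path on vertex set $[n]$. Then (a) every $t\in th(\mathcal{P})$ satisfies $t=\Omega(n2^{c\sqrt{\lg n}})$, where $c$ is any constant less than $1/\sqrt{2}$; (b) every $t\in th(\mathcal{P})$ satisfies $t=O(n2^{2\sqrt{\lg n}})$.
   Context: $\lg$ denotes logarithm base 2. A distribution of pebbles on a graph with vertex set $[n]$ is a function $D:[n]\to\mathbf{N}$; its size is $\sum_i D(i)$. A pebbling step removes two pebbles from a vertex and places one pebble on an adjacent vertex. A distribution is $z$-solvable if by pebbling steps one can get at least one pebble onto $z$, and solvable if it is $z$-solvable for every vertex $z$. For a graph sequence $\mathcal{G}=(G_n)$ with $V(G_n)=[n]$, $P_{\mathcal{G}}(n,t)$ is the probability that a uniformly random distribution of size $t$ (pebbles unlabeled, vertices labeled) is solvable on $G_n$. A function $t=t(n)$ is in $th(\mathcal{G})$ if for every $\omega=\omega(n)\to\infty$, $P_{\mathcal{G}}(n,t\omega)\to 1$ and $P_{\mathcal{G}}(n,t/\omega)\to 0$ as $n\to\infty$ (rounding to nearest integers). *)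

(* Defs.v *)
From Stdlib Require Import Relation_Operators.
From mathcomp Require Import all_boot all_order all_algebra.
From mathcomp Require Import all_classical all_reals all_analysis.
Import Order.TTheory GRing.Theory Num.Theory.
Import numFieldNormedType.Exports.

Set Implicit Arguments.
Unset Strict Implicit.
Unset Printing Implicit Defensive.

Record sgraph (V : finType) := SGraph {
  adj :> rel V;
  adj_sym : symmetric adj;
  adj_irr : irreflexive adj }.

Definition pebbling_step (V : finType) (G : sgraph V) (D D' : {ffun V -> nat}) :=
  exists u v : V, [/\ G u v, 2 <= D u &
    D' = [ffun w => D w - 2 * (w == u) + (w == v)]].

Definition reachable_by_pebbling (V : finType) (G : sgraph V) :=
  clos_refl_trans {ffun V -> nat} (pebbling_step G).

Definition solvable_at (V : finType) (G : sgraph V) (D : {ffun V -> nat}) (z : V) :=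
  exists2 D', reachable_by_pebbling G D D' & 1 <= D' z.

Definition solvable (V : finType) (G : sgraph V) (D : {ffun V -> nat}) :=
  forall z : V, solvable_at G D z.

(* In a distribution of size t every vertex carries at most t pebbles, so these
   distributions form a subset of the finite type {ffun V -> 'I_t.+1}. *)
Definition dists (V : finType) (t : nat) : {set {ffun V -> 'I_t.+1}} :=
  [set D : {ffun V -> 'I_t.+1} | \sum_(v : V) D v == t]%N.

Definition dist_val (V : finType) (t : nat) (D : {ffun V -> 'I_t.+1}) :
    {ffun V -> nat} :=
  [ffun v => D v : nat].

Definition solvable_dists (V : finType) (G : sgraph V) (t : nat) :
    {set {ffun V -> 'I_t.+1}} :=
  [set D in dists V t | `[< solvable G (dist_val D) >]].

Local Open Scope ring_scope.
Local Open Scope classical_set_scope.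

Definition solvable_prob (R : realType) (V : finType) (G : sgraph V) (t : nat) : R :=
  #|solvable_dists G t|%:R / #|dists V t|%:R.

(* Rounding to the nearest integer; negative reals are sent to 0. *)
Definition round_nat (R : realType) (x : R) : nat := Num.truncn (x + 2^-1).

(* The vertex set [n] is rendered as 'I_n. No sign condition is imposed on t:
   for n > 0 the empty distribution is not solvable, so the first limit already
   forces t n to be eventually positive. *)
Definition th (R : realType) (G : forall n : nat, sgraph 'I_n) : set (R^nat) :=
  [set t | forall omega : R^nat, omega n @[n --> \oo] --> +oo ->
    solvable_prob R (G n) (round_nat (t n * omega n)) @[n --> \oo] --> (1 : R) /\
    solvable_prob R (G n) (round_nat (t n / omega n)) @[n --> \oo] --> (0 : R)].

Definition path_adj (n : nat) : rel 'I_n :=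
  [rel i j : 'I_n | (i.+1 == j :> nat) || (j.+1 == i :> nat)].

Lemma path_adj_sym (n : nat) : symmetric (@path_adj n).
Proof. by move=> i j; exact: orbC. Qed.

Lemma path_adj_irr (n : nat) : irreflexive (@path_adj n).
Proof. by move=> i; rewrite /path_adj /= orbb gtn_eqF. Qed.

Definition path_graph (n : nat) : sgraph 'I_n :=
  SGraph (@path_adj_sym n) (@path_adj_irr n).

Definition lg (R : realType) (x : R) : R := ln x / ln 2.

(* Main.v *)
(** Uniform distributions of s pebbles on subsets of [n] are counted by binomial
    coefficients, whose ratios play the role of the geometric law of mean s / n.
    Put y = sqrt (lg n); it suffices to bound the solvability probability away
    from 1, respectively 0, uniformly in s, because a function t violating the
    conclusion yields, along a subsequence, some omega -> oo for which t omega
    (resp. t / omega) is infinitely often in the wrong range.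

    Lower bound.  Let s = O(n 2^m) with m ~ c y, and cut [n] into blocks of length
    L ~ 2m.  A given block is empty with probability about 2^(-mL) = 2^(-2m^2),
    which exceeds n^(-1+delta) since 2 c^2 < 1, so by the second moment method
    some block is empty with probability bounded below.  Given that, Markov's
    inequality bounds the weight sum_v D(v) 2^(-d(v,z)) seen from its centre z by
    a number below 1 with probability at least 1/2, and then z is unreachable.

    Upper bound.  Let s >= n 2^(2y) and y <= h <= y + 1.  If every window of h
    consecutive vertices holds a pile of 2^(h-1) pebbles, then D is solvable.  A
    given window fails with probability at most (2^(h-1) n / s)^h <= 2^(-y^2-y),
    and there are at most n = 2^(y^2) windows. *)

Require Import Defs.
From mathcomp Require Import all_boot all_order all_algebra.
From mathcomp Require Import all_classical all_reals all_analysis.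
From mathcomp Require Import perm zify ring lra.
Import Order.TTheory GRing.Theory Num.Theory.
Import numFieldNormedType.Exports.
Set Implicit Arguments.
Unset Strict Implicit.
Unset Printing Implicit Defensive.

(** * Counting distributions that avoid a set *)

Definition dists_off (V : finType) (s : nat) (B : {set V}) :
    {set {ffun V -> 'I_s.+1}} :=
  [set D in dists V s | [forall v in B, D v == 0 :> nat]].

Lemma dists_offP (V : finType) (s : nat) (B : {set V}) (D : {ffun V -> 'I_s.+1}) :
  reflect (\sum_v D v = s /\ forall v, v \in B -> D v = 0 :> nat)
          (D \in dists_off s B).
Proof.
rewrite !inE; apply: (iffP andP) => -[/eqP sD D0]; split => //.
  by move=> v vB; apply/eqP; move/forall_inP: D0; apply.
by apply/forall_inP => v vB; apply/eqP/D0.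
Qed.

Lemma dists_off0 (V : finType) (s : nat) : dists_off s (@finset.set0 V) = dists V s.
Proof.
apply/finset.setP => D; rewrite [LHS]inE; case: (D \in _) => //=.
by apply/forall_inP => v; rewrite inE.
Qed.

Lemma dists_offI (V : finType) (s : nat) (A B : {set V}) :
  dists_off s A :&: dists_off s B = dists_off s (A :|: B).
Proof.
apply/finset.setP => D; rewrite inE; apply/andP/dists_offP.
  move=> [/dists_offP[sD DA] /dists_offP[_ DB]]; split => // v.
  by rewrite inE => /orP[/DA|/DB].
by move=> [sD DAB]; split; apply/dists_offP; split => // v vA;
  rewrite DAB // inE vA ?orbT.
Qed.

Lemma sum_dists_off (V : finType) (s : nat) (B : {set V})
    (D : {ffun V -> 'I_s.+1}) :
  D \in dists_off s B -> \sum_(v in ~: B) D v = s.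
Proof.
move=> /dists_offP[sD D0]; rewrite -[RHS]sD big_mkcond /=; apply: eq_bigr => v _.
by rewrite inE; case: ifPn => // /negbNE /D0.
Qed.

(** Stars and bars: listing the m + 1 vertices outside B by [e] turns such a distribution into an (m
    + 1)-tuple with sum s, its values on B being forced. *)
Lemma card_dists_off (V : finType) (s m : nat) (B : {set V}) :
  #|~: B| = m.+1 -> #|dists_off s B| = 'C(m + s, m).
Proof.
move=> cB; rewrite -card_ord_partitions.
pose e (i : 'I_m.+1) : V := enum_val (cast_ord (esym cB) i).
have einj : injective e by move=> i j /enum_val_inj /cast_ord_inj.
have eB i : e i \in ~: B by exact: enum_valP.
have esurj v : v \in ~: B -> exists i, e i = v.
  move=> vB; exists (cast_ord cB (enum_rank_in vB v)).
  by rewrite /e cast_ordK enum_rankK_in.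
pose g (D : {ffun V -> 'I_s.+1}) := [tuple D (e i) | i < m.+1].
have sg D : \sum_(i <- g D) i = \sum_(v in ~: B) D v.
  rewrite big_tuple (reindex e) /=; last first.
    exists (fun v => if [pick i | e i == v] is Some i then i else ord0) => [i _|v vB].
      by case: pickP => [j /eqP /einj //|/(_ i)]; rewrite eqxx.
    case: pickP => [j /eqP //|/= nv]; have [i iv] := esurj _ vB.
    by have := nv i; rewrite iv eqxx.
  apply: congr_big => // i; first by rewrite eB.
  by rewrite tnth_mktuple.
rewrite -(@card_in_imset _ _ g); last first.
  move=> D D' /dists_offP[_ D0] /dists_offP[_ D0'] gE; apply/ffunP => v.
  apply: val_inj => /=; case: (boolP (v \in B)) => [vB|vB].
    by rewrite D0 // D0'.
  have [i <-] : exists i, e i = v by apply: esurj; rewrite inE.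
  have : tnth (g D) i = tnth (g D') i by rewrite gE.
  by rewrite !tnth_mktuple => ->.
apply: eq_card => t; rewrite [RHS]inE; apply/imsetP/eqP.
  by move=> [D DB ->]; rewrite sg sum_dists_off.
move=> st.
pose D := [ffun v => if [pick i | e i == v] is Some i then tnth t i else ord0].
have De i : D (e i) = tnth t i.
  by rewrite ffunE; case: pickP => [j /eqP /einj -> //|/(_ i)]; rewrite eqxx.
have gD : g D = t by apply: eq_from_tnth => i; rewrite tnth_mktuple De.
have D0 v : v \in B -> D v = 0 :> nat.
  move=> vB; rewrite ffunE; case: pickP => [j /eqP jv|//].
  by have := eB j; rewrite jv inE vB.
exists D => //; apply/dists_offP; split => //.
rewrite -[RHS]st -gD sg [RHS]big_mkcond /=; apply: eq_bigr => v _.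
by rewrite inE; case: ifPn => // /negbNE /D0.
Qed.

Lemma bin_diagS (m s : nat) :
  m.+1 * 'C(m.+1 + s, m.+1) = (m.+1 + s) * 'C(m + s, m).
Proof. by rewrite -mul_bin_diag addSn. Qed.

(** The ratio of the terms at a + 1 and a is (a + 1 + s) / (a + 1), which does not increase with a.
    This is the negative correlation between the emptiness of two disjoint blocks. *)
Lemma bin_log_concave (s a k l : nat) :
  'C(a + s, a) * 'C(a + k + l + s, a + k + l)
    <= 'C(a + k + s, a + k) * 'C(a + l + s, a + l).
Proof.
elim: l => [|l IH]; first by rewrite !addn0 mulnC.
have := bin_diagS (a + k + l) s; have := bin_diagS (a + l) s.
rewrite -!addnS => E1 E2.
set M := a + k + l.+1 in E2 *; set N := a + l.+1 in E1 *.
have NM : N <= M by rewrite /N /M; lia.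
rewrite -(@leq_pmul2l (M * N)); last by rewrite /M /N; lia.
move: IH E1 E2.
set x := 'C(a + s, _); set y := 'C(_ + l + s, _); set y' := 'C(M + s, _).
set z := 'C(a + k + s, _); set w := 'C(a + l + s, _); set w' := 'C(N + s, _).
move=> IH E1 E2.
have -> : M * N * (x * y') = N * (M + s) * (x * y).
  by rewrite -[(N * _) * _]mulnACA -[_ * y in RHS]E2; nia.
have -> : M * N * (z * w') = M * (N + s) * (z * w).
  by rewrite -[(M * (_ + _)) * _]mulnACA -[_ * w in RHS]E1; nia.
apply: leq_mul => //; nia.
Qed.

(** Each of the k successive ratios (a + i + s) / (a + i) is at most the first. This bounds from
    below the probability that a block of k vertices is empty. *)
Lemma bin_ratio_ge (s a k : nat) :
  'C(a + k + s, a + k) * a.+1 ^ k <= 'C(a + s, a) * (a.+1 + s) ^ k.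
Proof.
elim: k => [|k IH]; first by rewrite !addn0.
have := bin_diagS (a + k) s; rewrite -addnS => E.
rewrite -(@leq_pmul2l (a + k.+1)); last by rewrite addnS.
rewrite !mulnA E !expnS.
move: IH; set u := 'C(_ + k + s, _); set v := 'C(_, a) => IH.
rewrite (_ : _ * _ * _ = (a + k.+1 + s) * a.+1 * (u * a.+1 ^ k)); last by ring.
rewrite (_ : (a + _) * _ * _ = (a + k.+1) * (a.+1 + s) * (v * (a.+1 + s) ^ k)); last by ring.
by apply: leq_mul => //; nia.
Qed.

(** Each of the same k ratios is at least s / (a + k), which bounds that probability from above. *)
Lemma bin_ratio_le (s a k : nat) :
  'C(a + s, a) * s ^ k <= 'C(a + k + s, a + k) * (a + k) ^ k.
Proof.
elim: k => [|k IH]; first by rewrite !addn0.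
have := bin_diagS (a + k) s; rewrite -addnS => E.
rewrite !expnSr !mulnA.
apply: (@leq_trans ('C(a + k + s, a + k) * (a + k.+1) ^ k * s)).
  rewrite leq_mul2r; apply/orP; right; apply: (leq_trans IH).
  by rewrite leq_mul2l; apply/orP; right; case: k {IH E} => // k; rewrite leq_exp2r ?addnS.
rewrite mulnAC [X in _ <= X]mulnAC leq_mul2r; apply/orP; right.
rewrite [X in _ <= X]mulnC E mulnC leq_mul2r; apply/orP; right; lia.
Qed.

(** Transposing u and v permutes these distributions, since neither vertex is in B. *)
Lemma sum_dists_off_swap (V : finType) (s : nat) (B : {set V}) (u v : V) :
  u \notin B -> v \notin B ->
  \sum_(D in dists_off s B) D u = \sum_(D in dists_off s B) D v.
Proof.
move=> uB vB.
pose h (D : {ffun V -> 'I_s.+1}) := [ffun w => D (tperm u v w)].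
have hK : involutive h.
  by move=> D; apply/ffunP => w; rewrite !ffunE tpermK.
have hB D : D \in dists_off s B -> h D \in dists_off s B.
  move=> /dists_offP[sD D0]; apply/dists_offP; split.
    rewrite -[RHS]sD [RHS](reindex_inj (@perm_inj _ (tperm u v))) /=.
    by apply: eq_bigr => w _; rewrite ffunE.
  move=> w wB; rewrite ffunE; case: tpermP => [wu|wv|_ _]; last exact: D0.
    by rewrite -wu wB in uB.
  by rewrite -wv wB in vB.
rewrite (reindex_inj (inv_inj hK)) /=; apply: eq_big => [D|D _].
  by apply/idP/idP => [/hB|/hB //]; rewrite hK.
by rewrite ffunE tpermL.
Qed.

(** By exchangeability all vertices outside B have the same sum, and together these sums count each
    distribution s times. *)
Lemma sum_dists_off_at (V : finType) (s : nat) (B : {set V}) (u : V) :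
  u \notin B ->
  (\sum_(D in dists_off s B) D u) * #|~: B| = s * #|dists_off s B|.
Proof.
move=> uB; rewrite mulnC [RHS]mulnC -!sum_nat_const.
rewrite -[RHS](eq_bigr _ (fun D DB => sum_dists_off DB)) [RHS]exchange_big /=.
by apply: eq_bigr => v; rewrite inE => vB; apply: sum_dists_off_swap.
Qed.

(* Cauchy-Schwarz applied to the number N of events G i that occur, whose second
   moment is at most that of the number of events E i. *)
Lemma second_moment (T I : finType) (E G : I -> {set T}) (e W : nat) :
  (forall i, G i \subset E i) -> (forall i, #|E i| = e) ->
  (forall i, e <= 2 * #|G i|) ->
  (forall i j, i != j -> #|E i :&: E j| * W <= e ^ 2) ->
  0 < W -> W <= #|I| * e -> W <= 8 * #|finset.cover [set G i | i : I]|.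
Proof.
move=> GE cE cG cEE W0 WK.
set U := finset.cover _; set K := #|I|.
pose N x := \sum_i (x \in G i).
have sN : \sum_x N x = \sum_i #|G i|.
  rewrite exchange_big /=; apply: eq_bigr => i _.
  by rewrite -sum1_card [RHS]big_mkcond; apply: eq_bigr => x _; case: (x \in _).
have sN2 : \sum_x N x ^ 2 <= \sum_i \sum_j #|E i :&: E j|.
  have -> : \sum_i \sum_j #|E i :&: E j| =
            \sum_x \sum_i \sum_j (x \in E i :&: E j).
    rewrite [RHS]exchange_big /=; apply: eq_bigr => i _.
    rewrite [RHS]exchange_big /=; apply: eq_bigr => j _.
    by rewrite -sum1_card big_mkcond; apply: eq_bigr => x _; case: (x \in _).
  apply: leq_sum => x _; rewrite /N -mulnn big_distrlr /=.
  apply: leq_sum => i _; apply: leq_sum => j _; rewrite mulnb inE.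
  by case: andP => // -[/(fintype.subsetP (GE i)) -> /(fintype.subsetP (GE j)) ->].
(* The diagonal gives K * e * W, at most (K * e) ^ 2 because W <= K * e; the off-diagonal pairs give
   at most another (K * e) ^ 2. *)
have sE : (\sum_i \sum_j #|E i :&: E j|) * W <= 2 * (K * e) ^ 2.
  apply: (@leq_trans (\sum_(i : I) (e * W + K * e ^ 2))).
    rewrite big_distrl /=; apply: leq_sum => i _.
    rewrite (bigD1 i) //= finset.setIid cE mulnDl leq_add2l big_distrl /=.
    apply: (@leq_trans (\sum_(j : I) e ^ 2)); last by rewrite sum_nat_const.
    by rewrite big_mkcond /=; apply: leq_sum => j _; case: eqVneq => //= ji;
      apply: cEE; rewrite eq_sym.
  rewrite sum_nat_const -/K; nia.
set X := \sum_x N x in sN; set Y := \sum_x N x ^ 2 in sN2.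
have XK : K * e <= 2 * X.
  by rewrite sN big_distrr -sum_nat_const /=; apply: leq_sum => i _; apply: cG.
(* Cauchy-Schwarz in parametric form: 2ab <= a^2 + b^2 with a = x * N t and b = y, summed over the
   support U of N. *)
have CS x y : 2 * (x * y) * X <= x ^ 2 * Y + y ^ 2 * #|U|.
  rewrite -sum1_card big_mkcond !big_distrr -big_split /=.
  apply: leq_sum => t _.
  have [tU|tU] := boolP (t \in U).
    by have := nat_Cauchy (x * N t) y; rewrite muln1 expnMn; apply: leq_trans; nia.
  suff -> : N t = 0 by rewrite !muln0.
  apply: big1 => i _; apply/eqP; rewrite eqb0; apply: contra tU => tG.
  by apply/bigcupP; exists (G i) => //; apply: imset_f.
(* With k = K * e, these parameters give 4Wk^2 <= 2Wk^2 + 16k^2 #|U|, that is W <= 8 #|U|. *)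
have := CS W (4 * (K * e)).
have {}sN2 : Y * W <= 2 * (K * e) ^ 2.
  by apply: leq_trans sE; rewrite leq_mul2r sN2 orbT.
move: W0 WK XK sN2; set k := K * e; set u := #|U|; clearbody X Y k u.
move=> W0 WK XK sN2 H.
have k0 : 0 < k by apply: leq_trans WK.
rewrite -(@leq_pmul2l (2 * k ^ 2)); last by rewrite muln_gt0 expn_gt0 k0.
have : 2 * (W * (4 * k)) * X >= 4 * W * k ^ 2 by nia.
have : W ^ 2 * Y <= 2 * W * k ^ 2 by nia.
nia.
Qed.

(** * Pebbling on paths *)

Definition path_dist (n : nat) (u v : 'I_n) : nat := (u - v) + (v - u).

Lemma path_dist_step (n : nat) (u v z : 'I_n) :
  path_graph n u v -> path_dist u z <= (path_dist v z).+1.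
Proof. by rewrite /path_dist => /orP[] /eqP /= uv; lia. Qed.

Lemma path_dist_toward (n d : nat) (u z : 'I_n) :
  path_dist u z = d.+1 -> exists2 v, path_graph n u v & path_dist v z = d.
Proof.
rewrite /path_dist => uz; have [uLz|zLu] := ltnP u z.
  have u1 : u.+1 < n by have := ltn_ord z; lia.
  by exists (Ordinal u1); rewrite /= /path_adj /= ?eqxx //; lia.
have u1 : u.-1 < n by have := ltn_ord u; lia.
exists (Ordinal u1); rewrite /=; last lia.
by apply/orP; right; apply/eqP => /=; lia.
Qed.

(* The usual weight sum_v D v / 2 ^ dist v z, scaled by 2 ^ n to stay in nat; the
   truncated subtraction is harmless since distances in the path are below n. *)
Definition weight (n : nat) (z : 'I_n) (D : {ffun 'I_n -> nat}) : nat :=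
  \sum_v D v * 2 ^ (n - path_dist v z).

(** A step from u to v trades two pebbles of weight f u for one of weight f v, and f v <= 2 * f u
    because v is at most one closer to z. *)
Lemma weight_step (n : nat) (z : 'I_n) (D D' : {ffun 'I_n -> nat}) :
  pebbling_step (path_graph n) D D' -> weight z D' <= weight z D.
Proof.
move=> [u [v [uv Du ->]]]; rewrite /weight.
set f := fun w : 'I_n => 2 ^ (n - path_dist w z).
have pick1 w : f w = \sum_x (x == w) * f x.
  rewrite (bigD1 w) //= eqxx mul1n big1 ?addn0 // => x /negPf ->.
  by rewrite mul0n.
have : \sum_w [ffun w => D w - 2 * (w == u) + (w == v)] w * f w + 2 * f u
       = \sum_w D w * f w + f v.
  rewrite (pick1 u) (pick1 v) big_distrr -!big_split /=.
  apply: eq_bigr => w _; rewrite ffunE.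
  have : 2 * (w == u) <= D w by case: eqVneq => [->|_]; rewrite ?muln1.
  move=> H; rewrite mulnDl mulnBl -!mulnA addnAC subnK // mulnA leq_mul2r H orbT //.
have : f v <= 2 * f u.
  rewrite -expnS leq_exp2l //.
  by have := path_dist_step z uv; rewrite /path_dist; lia.
by move=> fvu E; rewrite -(leq_add2r (2 * f u)) E leq_add2l.
Qed.

Lemma weight_solvable (n : nat) (z : 'I_n) (D : {ffun 'I_n -> nat}) :
  solvable_at (path_graph n) D z -> 2 ^ n <= weight z D.
Proof.
move=> [D' DD' D'z]; apply: (@leq_trans (weight z D')).
  rewrite /weight (bigD1 z) //= /path_dist subnn subn0.
  by apply: leq_trans (leq_addr _ _); rewrite leq_pmull.
elim: DD' => [D1 D2 /weight_step|//|D1 D2 D3 _ + _]; first exact.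
by move=> w12 w23; apply: leq_trans w12.
Qed.

Lemma move_pile (V : finType) (G : sgraph V) (k : nat) (u v : V)
    (D : {ffun V -> nat}) :
  G u v -> 2 * k <= D u ->
  exists2 D', reachable_by_pebbling G D D' & D v + k <= D' v.
Proof.
move=> uv; have vu : v != u by apply: contraL uv => /eqP ->; rewrite adj_irr.
elim: k D => [|k IH] D kD.
  by exists D; [exact: Relation_Operators.rt_refl | rewrite addn0].
pose D1 := [ffun w => D w - 2 * (w == u) + (w == v)].
have DD1 : pebbling_step G D D1 by exists u, v; split => //; lia.
have [|D' D1D' D'v] := IH D1.
  by rewrite ffunE eqxx eq_sym (negPf vu); lia.
exists D'; last by move: D'v; rewrite ffunE eqxx (negPf vu); lia.
by apply: Relation_Operators.rt_trans D1D'; apply: Relation_Operators.rt_step.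
Qed.

(** Moving half of the required pile one vertex closer to z halves both the requirement and the
    supply. *)
Lemma solvable_at_pile (n : nat) (u z : 'I_n) (D : {ffun 'I_n -> nat}) :
  2 ^ path_dist u z <= D u -> solvable_at (path_graph n) D z.
Proof.
move d : (path_dist u z) => k; elim: k u D d => [|k IH] u D uz Du.
  have <- : u = z by apply: val_inj => /=; move: uz; rewrite /path_dist; lia.
  by exists D => //; exact: Relation_Operators.rt_refl.
have [v uv vz] := path_dist_toward uz.
have [|D' DD' D'v] := @move_pile _ (path_graph n) (2 ^ k) u v D uv.
  by rewrite -expnS.
have [|D2 D'D2 D2z] := IH v D' vz.
  by apply: leq_trans D'v; rewrite leq_addl.
by exists D2 => //; apply: Relation_Operators.rt_trans DD' D'D2.
Qed.

(** * Windows of the path *)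

Definition window (n a l : nat) : {set 'I_n} := [set v : 'I_n | a <= v < a + l].

Lemma card_window (n a l : nat) : a + l <= n -> #|window n a l| = l.
Proof.
move=> aln; have lt_n (i : 'I_l) : a + i < n by have := ltn_ord i; lia.
have finj : injective (fun i => Ordinal (lt_n i)).
  by move=> i j /(congr1 val) /= /addnI /val_inj.
rewrite -[RHS]card_ord -cardsT -(card_imset _ finj).
apply: eq_card => v; rewrite inE; apply/idP/imsetP.
  move=> av; have il : v - a < l by lia.
  by exists (Ordinal il) => //; apply: val_inj => /=; lia.
by move=> [i _ ->] /=; have := ltn_ord i; lia.
Qed.

(** Encode D by its restriction [lo] to B together with [hi], where all pebbles of B have been moved
    to a fixed vertex x outside B. The pair determines D, and [hi] has size s and vanishes on B. *)
Lemma card_dists_low (V : finType) (s a : nat) (B : {set V}) :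
  B != [set: V] ->
  #|[set D in dists V s | [forall v in B, D v < a]]|
    <= a ^ #|B| * #|dists_off s B|.
Proof.
rewrite finset.eqEsubset finset.subsetT /= => /fintype.subsetPn[x _ xB].
set S := [set D in _ | _].
pose lo (D : {ffun V -> 'I_s.+1}) : {ffun V -> 'I_s.+1} :=
  [ffun v => if v \in B then D v else ord0].
pose hi (D : {ffun V -> 'I_s.+1}) : {ffun V -> 'I_s.+1} :=
  [ffun v => if v \in B then ord0 else
             if v == x then inord (D x + \sum_(w in B) D w) else D v].
have SP D : D \in S -> \sum_v D v = s /\ forall v, v \in B -> D v < a.
  rewrite !inE => /andP[/eqP sD Da]; split => // v.
  by move/forall_inP: Da; apply.
have sumx D : D \in S ->
    D x + \sum_(w in B) D w + \sum_(v | (v \notin B) && (v != x)) D v = s.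
  move=> /SP[sD _]; rewrite -[RHS]sD [RHS](bigID (mem B)) /=.
  by rewrite [X in _ = _ + X](bigD1 x) //=; lia.
pose Q := [set f in pffun_on (ord0 : 'I_s.+1) (mem B) [pred i : 'I_s.+1 | i < a]].
have injg : {in S &, injective (fun D => (lo D, hi D))}.
  move=> D D' DS D'S [/ffunP elo /ffunP ehi]; apply/ffunP => v.
  have eB w : w \in B -> D w = D' w.
    by move=> wB; have := elo w; rewrite !ffunE wB.
  have [/eB //|vB] := boolP (v \in B).
  have sB : \sum_(w in B) D w = \sum_(w in B) D' w :> nat.
    by apply: eq_bigr => w /eB ->.
  have := ehi v; rewrite !ffunE (negPf vB); case: eqVneq => // -> /(congr1 val) /=.
  (* The pile on x is still at most s, so [inord] does not fall back to its default value. *)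
  rewrite !inordK ?ltnS; last 2 first.
  - by rewrite -[X in _ <= X](sumx _ D'S) leq_addr.
  - by rewrite -[X in _ <= X](sumx _ DS) leq_addr.
  by rewrite sB => /addIn; exact: val_inj.
rewrite -(card_in_imset injg).
apply: (@leq_trans #|finset.setX Q (dists_off s B)|); last first.
  rewrite cardsX leq_mul2r; apply/orP; right.
  rewrite cardsE card_pffun_on; case: #|B| => // b; rewrite leq_exp2r //.
  (* Only an inequality: when a > s.+1 there are fewer than a values available in 'I_s.+1. *)
  rewrite cardE -(size_map val) -[X in _ <= X](size_iota 0).
  apply: uniq_leq_size; first by rewrite (map_inj_uniq val_inj) enum_uniq.
  by move=> _ /mapP[i + ->]; rewrite mem_enum mem_iota.

apply: fintype.subset_leq_card; apply/fintype.subsetP => _ /imsetP[D DS ->].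
have [sD Da] := SP _ DS; rewrite inE /=; apply/andP; split.
  rewrite inE; apply/pffun_onP; split.
    apply/fintype.subsetP => v; rewrite !inE ffunE.
    by case: (v \in B); rewrite // eqxx.
  by move=> _ /fintype.imageP[v vB ->]; rewrite ffunE vB inE Da.
apply/dists_offP; split; last by move=> v vB; rewrite ffunE vB.
rewrite (bigID (mem B)) /= big1 => [|v vB]; last by rewrite ffunE vB.
have := sumx _ DS => sx.
rewrite (bigD1 x) //= ffunE (negPf xB) eqxx inordK; last by rewrite ltnS -[X in _ <= X]sx leq_addr.
rewrite -[RHS]sx add0n; congr (_ + _); apply: eq_bigr => v /andP[vB vx].
by rewrite ffunE (negPf vB) (negPf vx).
Qed.

Lemma sum_exp2_inj (T : finType) (P : pred T) (f : T -> nat) (M : nat) :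
  {in P &, injective f} -> (forall x, P x -> f x < M) ->
  \sum_(x | P x) 2 ^ f x <= 2 ^ M.
Proof.
move=> finj fM; apply: (@leq_trans (\sum_(i < M) 2 ^ i)); last first.
  elim: M {fM} => [|M IH]; first by rewrite big_ord0.
  by rewrite big_ord_recr /= expnS mul2n -addnn leq_add2r.
have -> : \sum_(x | P x) 2 ^ f x = \sum_(x | P x) \sum_(i < M) (f x == i) * 2 ^ i.
  apply: eq_bigr => x Px; rewrite (bigD1 (Ordinal (fM _ Px))) //= eqxx mul1n.
  rewrite big1 ?addn0 // => i; rewrite -val_eqE /= eq_sym => /negPf ->.
  by rewrite mul0n.
rewrite exchange_big /=; apply: leq_sum => i _.
rewrite -big_distrl /= -[X in _ <= X]mul1n leq_mul2r; apply/orP; right.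
case: (pickP [pred x | P x && (f x == i)]) => [y /= /andP[Py /eqP yi]|no].
  rewrite (bigD1 y) //= yi eqxx big1 // => x /andP[Px xy].
  by case: eqP => // xi; case/eqP: xy; apply: finj => //; rewrite xi.
by rewrite big1 // => x Px; have := no x; rewrite /= Px /= => ->.
Qed.

(** On each side of z the distances are distinct, so each side is dominated by a geometric sum of
    powers of 2 with exponents below n - h. *)
Lemma weight_tail (n h : nat) (z : 'I_n) :
  \sum_(v : 'I_n | h < path_dist v z) 2 ^ (n - path_dist v z) <= 2 * 2 ^ (n - h).
Proof.
rewrite (bigID (fun v : 'I_n => z < v)) /= mul2n -addnn /path_dist.
by apply: leq_add; apply: sum_exp2_inj => [u v|v];
  have := ltn_ord z; have := ltn_ord v; rewrite ?inE;
  [move: (ltn_ord u); rewrite /in_mem /= => *; apply: val_inj => /=; lia | lia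
  |move: (ltn_ord u); rewrite /in_mem /= => *; apply: val_inj => /=; lia | lia].
Qed.

(** * Bounds on the number of solvable distributions *)

Lemma card_dists_off_ord (n s : nat) (B : {set 'I_n}) :
  #|B| < n -> #|dists_off s B| = 'C((n - #|B|).-1 + s, (n - #|B|).-1).
Proof.
move=> Bn; apply: card_dists_off.
have := cardsC B; rewrite card_ord; lia.
Qed.

Lemma card_dists_ord (n s : nat) : #|dists 'I_n.+1 s| = 'C(n + s, n).
Proof. by rewrite -dists_off0 card_dists_off_ord cards0 ?subn0. Qed.

(* An unsolvable vertex z leaves a window of h consecutive vertices containing z
   without any pile of 2 ^ (h - 1) pebbles. *)
Lemma card_unsolvable_le (n h s : nat) : 0 < h < n ->
  #|dists 'I_n s :\: solvable_dists (path_graph n) s| * s ^ h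
    <= n * (2 ^ h.-1 * n) ^ h * #|dists 'I_n s|.
Proof.
case: n => [|n] /andP[h0 hn]; first by [].
(* The window starts at z, or is pushed left to fit near the right end; either way it contains z, so
   its vertices are at distance at most h - 1 from z. *)
pose B (z : 'I_n.+1) := window n.+1 (minn z (n.+1 - h)) h.
have cB z : #|B z| = h by apply: card_window; lia.
pose low z := [set D in dists 'I_n.+1 s | [forall v in B z, D v < 2 ^ h.-1]].
have cover : #|dists 'I_n.+1 s :\: solvable_dists (path_graph n.+1) s|
    <= \sum_z #|low z|.
  rewrite -sum1_card big_mkcond /=.
  apply: (@leq_trans (\sum_D \sum_z (D \in low z))).
    apply: leq_sum => D _; case: ifPn => //.
    rewrite inE => /andP[+ Ds]; rewrite inE Ds /= => /asboolPn.
    move=> /existsNP[z Dz]; rewrite (bigD1 z) //=.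
    suff -> : D \in low z by [].
    rewrite inE Ds /=; apply/forall_inP => v; rewrite inE => vB.
    rewrite ltnNge; apply/negP => Dv; apply: Dz.
    apply: (@solvable_at_pile _ v); rewrite ffunE; apply: leq_trans Dv.
    by rewrite leq_exp2l // /path_dist; have := ltn_ord z; lia.
  rewrite exchange_big /=; apply: leq_sum => z _.
  by rewrite -sum1_card [X in _ <= X]big_mkcond /=; apply: leq_sum => D _; case: (_ \in _).
have cl z : #|low z| * s ^ h <= (2 ^ h.-1 * n.+1) ^ h * #|dists 'I_n.+1 s|.
  have BT : B z != [set: 'I_n.+1].
    by apply/eqP => /(congr1 (fun A : {set _} => #|A|)); rewrite cB cardsT card_ord; lia.
  apply: (@leq_trans ((2 ^ h.-1) ^ h * #|dists_off s (B z)| * s ^ h)).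
    by rewrite leq_mul2r; apply/orP; right; rewrite -[X in _ ^ X * _](cB z);
      apply: card_dists_low.
  rewrite expnMn -!mulnA leq_mul2l; apply/orP; right.
  rewrite card_dists_off_ord cB // card_dists_ord.
  apply: (leq_trans (bin_ratio_le _ _ _)).
  have -> : (n.+1 - h).-1 + h = n by lia.
  by rewrite mulnC leq_mul2r leq_exp2r // leqnSn orbT.
apply: (@leq_trans ((\sum_z #|low z|) * s ^ h)).
  by rewrite leq_mul2r cover orbT.
rewrite big_distrl /= -mulnA; set c := (X in n.+1 * X).
rewrite (_ : n.+1 * c = \sum_(z < n.+1) c); last by rewrite sum_nat_const card_ord.
by apply: leq_sum => z _; apply: cl.
Qed.

Lemma markov_card (T : finType) (A : {set T}) (f : T -> nat) (c : nat) :
  #|[set x in A | c <= f x]| * c <= \sum_(x in A) f x.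
Proof.
rewrite -sum_nat_const big_mkcond [X in _ <= X]big_mkcond /=.
by apply: leq_sum => x _; rewrite inE; case: (x \in A) => //=; case: ifP.
Qed.

(** Given that B is empty, a vertex outside B has mean s / (n - #|B|) <= 2^(m+2). By [weight_tail]
    the mean weight is at most 2^(n-h+m+3) = 2^(n-1), and Markov's inequality leaves at least half
    of the distributions. *)
Lemma card_light_ge (n m h s : nat) (z : 'I_n) (B : {set 'I_n}) :
  h = m + 4 -> (forall v, v \notin B -> h < path_dist v z) ->
  2 * #|B| <= n -> h < n -> s <= n * 2 ^ m.+1 ->
  #|dists_off s B|
    <= 2 * #|[set D in dists_off s B | weight z (dist_val D) < 2 ^ n]|.
Proof.
move=> hm Bz Bn hn sn.
set E := dists_off s B; set G := [set D in E | _].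
pose H := [set D in E | 2 ^ n <= weight z (dist_val D)].
have EGH : #|E| = #|G| + #|H|.
  rewrite -(cardsID [set D | weight z (dist_val D) < 2 ^ n] E); congr (_ + _).
    by apply: eq_card => D; rewrite !inE andbC.
  by apply: eq_card => D; rewrite !inE -leqNgt andbC.
have cBC : #|~: B| = n - #|B| by have := cardsC B; rewrite card_ord; lia.
have HE : #|H| * 2 ^ n * (n - #|B|) <= 2 * 2 ^ (n - h) * s * #|E|.
  apply: (@leq_trans ((\sum_(D in E) weight z (dist_val D)) * (n - #|B|))).
    by rewrite leq_mul2r markov_card orbT.
  rewrite /weight exchange_big big_distrl /= -mulnA.
  apply: (@leq_trans (\sum_(v : 'I_n | h < path_dist v z)
                        2 ^ (n - path_dist v z) * (s * #|E|))).
    rewrite [X in _ <= X]big_mkcond /=; apply: leq_sum => v _.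
    rewrite (eq_bigr (fun D : {ffun 'I_n -> 'I_s.+1} =>
      D v * 2 ^ (n - path_dist v z))) => [|D _]; last by rewrite ffunE.
    rewrite -big_distrl /= mulnAC -cBC.
    have [vB|vB] := boolP (v \in B).
      by rewrite big1 // => D /dists_offP[_ ->].
    by rewrite sum_dists_off_at // Bz // mulnC.
  by rewrite -big_distrl /= leq_mul2r weight_tail orbT.
suff : 2 * #|H| <= #|E| by lia.
have n0 : 0 < n by lia.
have {}HE : 4 * #|H| * (n - #|B|) <= n * #|E|.
  have e1 : 2 ^ n = 2 ^ (n - h) * 2 ^ m * 16.
    by rewrite -mulnA -(expnD 2 m 4) -expnD; congr (2 ^ _); lia.
  have e2 : 2 ^ m.+1 = 2 * 2 ^ m by rewrite expnS.
  have p1 : 0 < 2 ^ (n - h) by rewrite expn_gt0.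
  have p2 : 0 < 2 ^ m by rewrite expn_gt0.
  rewrite -(@leq_pmul2l (2 ^ (n - h) * 2 ^ m * 4)); last by rewrite !muln_gt0 p1 p2.
  move: HE sn; rewrite e1 e2; set p := 2 ^ (n - h); set q := 2 ^ m.
  set c := n - #|B|; move: #|H| #|E| => x e HE sn.
  apply: (@leq_trans (x * (p * q * 16) * c)); first by apply: eq_leq; ring.
  apply: (leq_trans HE).
  apply: (@leq_trans (2 * p * (n * (2 * q)) * e)); last by apply: eq_leq; ring.
  by rewrite leq_mul2r leq_mul2l sn !orbT.
rewrite -(@leq_pmul2l n) //; apply: leq_trans HE.
have : n <= 2 * (n - #|B|) by lia.
nia.
Qed.

(** Second moment method with W the number of all distributions: the size of n makes the expected
    number of empty blocks at least 1, so at least 1/8 of the distributions have an empty block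
    whose centre is light, hence unreachable. *)
Lemma card_solvable_le (n m s : nat) :
  2 ^ ((m + 4) * (2 * m + 9)) <= n -> s <= n * 2 ^ m.+1 ->
  8 * #|solvable_dists (path_graph n) s| <= 7 * #|dists 'I_n s|.
Proof.
(* L = 2(m + 4) + 1, so that a block is exactly the ball of radius m + 4 about its centre. *)
set L := 2 * m + 9 => nbig sn.
have mL : (m + 4) * L = (m + 3) * L + L by ring.
have Lexp : 4 * L <= 2 ^ ((m + 4) * L).
  apply: (@leq_trans (2 ^ (2 + L))); last by rewrite leq_exp2l // /L; nia.
  by rewrite expnD leq_mul2l /= ltnW // ltn_expl.
have nL : 4 * L <= n by apply: leq_trans nbig.
have L0 : 0 < L by rewrite /L; lia.
pose K := n %/ L.
have KL : K * L <= n by rewrite leq_trunc_div.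
have blk (j : 'I_K) : j * L + L <= n.
  by apply: leq_trans KL; rewrite -mulSnr leq_mul2r ltn_ord orbT.
have lt_z (j : 'I_K) : j * L + (m + 4) < n.
  by apply: leq_trans (blk j); rewrite /L; lia.
pose z j := Ordinal (lt_z j).
pose B (j : 'I_K) := window n (j * L) L.
have cB j : #|B j| = L by apply: card_window.
have Bz j v : v \notin B j -> m + 4 < path_dist v (z j).
  by rewrite inE /path_dist /=; move: (j * L) => a; rewrite /L; lia.
pose E j := dists_off s (B j).
pose G j := [set D in E j | weight (z j) (dist_val D) < 2 ^ n].
have cU i j : i != j -> #|B i :|: B j| = 2 * L.
  move=> ij; rewrite cardsU !cB (_ : B i :&: B j = finset.set0).
    by rewrite cards0 subn0 mul2n addnn.
  apply/finset.setP => v; rewrite !inE; apply/negP => /andP[vi vj].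
  have : i != j :> nat by [].
  move: (val i) (val j) vi vj => a b; rewrite -!mulSnr => /andP[av va] /andP[bv vb].
  have : a < b.+1 by rewrite -(ltn_pmul2r L0); lia.
  have : b < a.+1 by rewrite -(ltn_pmul2r L0); lia.
  lia.
pose e := 'C((n - L).-1 + s, (n - L).-1).
have cE j : #|E j| = e by rewrite card_dists_off_ord cB //; lia.
have cD : #|dists 'I_n s| = 'C(n.-1 + s, n.-1).
  by case: (n) nL => [|k _]; [lia | rewrite card_dists_ord].
have cG j : e <= 2 * #|G j|.
  by rewrite -(cE j); apply: (card_light_ge (erefl _) (@Bz j)); rewrite ?cB //;
    lia.
have cEE i j : i != j -> #|E i :&: E j| * #|dists 'I_n s| <= e ^ 2.
  move=> ij; rewrite dists_offI card_dists_off_ord ?cU //; last lia.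
  have := bin_log_concave s (n - 2 * L).-1 L L.
  have -> : (n - 2 * L).-1 + L + L = n.-1 by lia.
  have -> : (n - 2 * L).-1 + L = (n - L).-1 by lia.
  by rewrite cD -mulnn.
have WK : #|dists 'I_n s| <= #|'I_K| * e.
  have := bin_ratio_ge s (n - L).-1 L.
  have -> : (n - L).-1 + L = n.-1 by lia.
  have -> : (n - L).-1.+1 = n - L by lia.
  rewrite -cD -/e card_ord => H.
  have c0 : 0 < n - L by lia.
  (* Since n <= 2(n - L), the left side is at most 5 * 2^m * (n - L). Hence a block is empty with
     probability at least 2^(-(m+3)L). *)
  have cs : n - L + s <= (n - L) * 2 ^ (m + 3).
    have : 2 ^ m.+1 = 2 * 2 ^ m by rewrite expnS.
    have : 2 ^ (m + 3) = 2 ^ m * 8 by rewrite expnD.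
    have : 0 < 2 ^ m by rewrite expn_gt0.
    move: sn; set q := 2 ^ m => sn q0 -> q1; rewrite q1 in sn.
    have : n * (2 * q) <= 2 * (n - L) * (2 * q) by rewrite leq_mul2r; lia.
    have : n - L <= (n - L) * q by rewrite leq_pmulr.
    lia.
  (* The spare factor 2^L in the bound on n pays for the division by L. *)
  have pK : 2 ^ ((m + 3) * L) <= K.
    rewrite leq_divRL //; apply: leq_trans nbig; rewrite mL expnD leq_mul2l.
    by rewrite ltnW ?orbT // ltn_expl.
  rewrite -(@leq_pmul2r ((n - L) ^ L)); last by rewrite expn_gt0 c0.
  apply: (leq_trans H); rewrite (mulnC K) -mulnA leq_mul2l; apply/orP; right.
  apply: (@leq_trans (((n - L) * 2 ^ (m + 3)) ^ L)); first by rewrite leq_exp2r.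
  by rewrite expnMn -expnM mulnC leq_mul2r pK orbT.
have W0 : 0 < #|dists 'I_n s| by rewrite cD bin_gt0 leq_addr.
have GE j : G j \subset E j by apply/fintype.subsetP => D; rewrite inE => /andP[].
have := second_moment GE cE cG cEE W0 WK; set U := finset.cover _ => WU.
have US : solvable_dists (path_graph n) s \subset dists 'I_n s :\: U.
  apply/fintype.subsetP => D; rewrite !inE => /andP[-> /asboolP Dsol].
  rewrite andbT; apply/bigcupP => -[_ /imsetP[j _ ->]].
  by rewrite inE ltnNge weight_solvable ?andbF.
have UD : U \subset dists 'I_n s.
  apply/fintype.subsetP => D /bigcupP[_ /imsetP[j _ ->]].
  by rewrite inE => /andP[+ _]; rewrite inE => /andP[].
have := fintype.subset_leq_card US; rewrite cardsD (finset.setIidPr UD).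
have := fintype.subset_leq_card UD; lia.
Qed.

(** * Asymptotics *)

Local Open Scope ring_scope.
Local Open Scope classical_set_scope.

Lemma powR2_lg (R : realType) (x : R) : 0 < x -> 2 `^ lg x = x.
Proof.
move=> x0; apply: ln_inj; rewrite ?posrE ?powR_gt0 //.
by rewrite ln_powR /lg divfK // gt_eqF // ln_gt0 // ltr1n.
Qed.

Lemma ler_powR2 (R : realType) (x y : R) : (2 `^ x <= 2 `^ y) = (x <= y).
Proof.
have l2 : 0 < ln 2 :> R by rewrite ln_gt0 // ltr1n.
by rewrite -[LHS]ler_ln ?posrE ?powR_gt0 // !ln_powR ler_pM2r.
Qed.

Lemma powR2D (R : realType) (x y : R) : 2 `^ (x + y) = 2 `^ x * 2 `^ y.
Proof. by rewrite powRD // pnatr_eq0 implybT. Qed.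

Lemma powR2_nat (R : realType) (k : nat) : 2 `^ (k%:R : R) = (2 ^ k)%:R.
Proof. by rewrite powR_mulrn // natrX. Qed.

Lemma solvable_prob_le (R : realType) (V : finType) (G : sgraph V) (s p q : nat) :
  (0 < q)%N -> (q * #|solvable_dists G s| <= p * #|dists V s|)%N ->
  solvable_prob R G s <= p%:R / q%:R.
Proof.
move=> q0 H; rewrite /solvable_prob.
(* If there is no distribution at all, the quotient is 0 by convention. *)
have [->|d0] := posnP #|dists V s|; first by rewrite invr0 mulr0 divr_ge0.
rewrite ler_pdivrMr ?ltr0n // mulrAC ler_pdivlMr ?ltr0n //.
by rewrite -!natrM ler_nat mulnC.
Qed.

Lemma solvable_prob_ge (R : realType) (V : finType) (G : sgraph V) (s p q : nat) :
  (0 < q)%N -> (0 < #|dists V s|)%N ->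
  (p * #|dists V s| <= q * #|solvable_dists G s|)%N ->
  p%:R / q%:R <= solvable_prob R G s.
Proof.
move=> q0 d0 H; rewrite /solvable_prob.
rewrite ler_pdivlMr ?ltr0n // mulrAC ler_pdivrMr ?ltr0n //.
by rewrite -!natrM ler_nat [X in (_ <= X)%N]mulnC.
Qed.

Lemma near_sqrt_lg_ge (R : realType) (y : R) :
  \forall n \near \oo, y <= Num.sqrt (lg (n%:R : R)).
Proof.
near=> n.
have n2 : 2 `^ (y ^+ 2) <= n%:R :> R by near: n; apply: nbhs_infty_ger.
have n0 : 0 < n%:R :> R by apply: lt_le_trans n2; rewrite powR_gt0.
apply: le_trans (ler_norm y) _; rewrite -sqrtr_sqr ler_wsqrtr //.
by rewrite -ler_powR2 powR2_lg.
Unshelve. all: by end_near. Qed.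

(** Writing n as 2^(y^2) reduces the later estimates to polynomial inequalities between
    exponents. *)
Lemma sqr_sqrt_lg (R : realType) (n : nat) : (0 < n)%N ->
  2 `^ (Num.sqrt (lg (n%:R : R)) ^+ 2) = n%:R.
Proof.
move=> n0; rewrite sqr_sqrtr ?powR2_lg ?ltr0n //.
by rewrite -ler_powR2 powR2_lg ?ltr0n // powRr0 ler1n.
Qed.

(** The added 1 leaves room for rounding. *)
Lemma near_solvable_prob_le (R : realType) (c : R) : c < 1 / Num.sqrt 2 ->
  \forall n \near \oo, forall s : nat,
    s%:R <= n%:R * 2 `^ (c * Num.sqrt (lg (n%:R : R))) + 1 ->
    solvable_prob R (path_graph n) s <= 7 / 8.
Proof.
(* A negative c is replaced by 0, so that squaring the bound on c is legitimate. *)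
move=> clt; pose c1 := Num.max c 0.
have c10 : 0 <= c1 by rewrite le_max lexx orbT.
have c1lt : 2 * c1 ^+ 2 < 1.
  have s2 : 0 < Num.sqrt 2 :> R by rewrite sqrtr_gt0.
  have c1s : c1 * Num.sqrt 2 < 1.
    by rewrite -ltr_pdivlMr // gt_max clt divr_gt0.
  by rewrite mulrC -[X in _ * X](sqr_sqrtr (ler0n R 2)) -exprMn expr_lt1 // mulr_ge0 // ltW.
near=> n => s sn.
have n0 : (0 < n)%N by near: n; apply: nbhs_infty_ge.
have y1 : 1 <= Num.sqrt (lg (n%:R : R)) by near: n; apply: near_sqrt_lg_ge.
(* The exponent (m + 4)(2m + 9) is at most (c1 y + 5)(2 c1 y + 11) = 2 c1^2 y^2 + 21 c1 y + 55; this
   threshold, with y >= 1, brings it below y^2. *)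
have yd : (21 * c1 + 55) / (1 - 2 * c1 ^+ 2) <= Num.sqrt (lg (n%:R : R)).
  by near: n; apply: near_sqrt_lg_ge.
set y := Num.sqrt _ in sn y1 yd.
pose m := (Num.truncn (c1 * y)).+1.
have cy0 : 0 <= c1 * y by rewrite mulr_ge0 // (le_trans _ y1).
have /andP[m1 m2] := truncn_itv cy0.
have mle : m%:R <= c1 * y + 1 by rewrite -[m]addn1 natrD lerD2r.
apply: solvable_prob_le => //; apply: (@card_solvable_le _ m).
  rewrite -(ler_nat R) -powR2_nat -(sqr_sqrt_lg R n0) ler_powR2 -/y.
  rewrite natrM !natrD natrM.
  apply: (@le_trans _ _ ((c1 * y + 5) * (2 * (c1 * y) + 11))).
    apply: ler_pM; rewrite ?addr_ge0 ?mulr_ge0 //; lra.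
  have : 21 * c1 + 55 <= y * (1 - 2 * c1 ^+ 2).
    by rewrite -ler_pdivrMr // subr_gt0.
  nra.
rewrite -(ler_nat R); apply: (le_trans sn).
rewrite expnS !natrM -powR2_nat.
have : 2 `^ (c * y) <= 2 `^ m%:R.
  rewrite ler_powR2; apply: le_trans (ltW m2).
  by rewrite ler_wpM2r ?(le_trans _ y1) // le_max lexx.
have : 1 <= n%:R :> R by rewrite ler1n.
have : 1 <= 2 `^ m%:R :> R by rewrite -[X in X <= _](powRr0 2) ler_powR2.
nra.
Unshelve. all: by end_near. Qed.

Lemma near_solvable_prob_ge (R : realType) :
  \forall n \near \oo, forall s : nat,
    n%:R * 2 `^ (2 * Num.sqrt (lg (n%:R : R))) <= s%:R ->
    1 / 2 <= solvable_prob R (path_graph n) s.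
Proof.
near=> n => s sn.
have n0 : (0 < n)%N by near: n; apply: nbhs_infty_ge.
have y2 : 2 <= Num.sqrt (lg (n%:R : R)) by near: n; apply: near_sqrt_lg_ge.
have yn := sqr_sqrt_lg R n0.
set y := Num.sqrt _ in sn y2 yn.
have y0 : 0 <= y by apply: le_trans y2.
pose h := (Num.truncn y).+1.
have /andP[h1 h2] : y <= h%:R <= y + 1.
  have /andP[t1 t2] := truncn_itv y0.
  by rewrite (ltW t2) /= -[h]addn1 natrD lerD2r.
(* Here h < 2^h <= 2^(y+1) <= 2^(y^2), the last because y >= 2. *)
have hn : (h < n)%N.
  apply: leq_trans (ltn_expl h (ltnSn 1)) _.
  rewrite -(ler_nat R) -powR2_nat -yn ler_powR2; nra.
have D0 : (0 < #|dists 'I_n s|)%N.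
  by case: (n) n0 => // k _; rewrite card_dists_ord bin_gt0 leq_addr.
have s0 : (0 < s)%N.
  rewrite -(ltr_nat R); apply: lt_le_trans sn.
  by rewrite mulr_gt0 ?ltr0n ?powR_gt0.
have key : (2 * (n * (2 ^ h.-1 * n) ^ h) <= s ^ h)%N.
  rewrite -(ler_nat R) natrX; apply: le_trans (lerXn2r h _ _ sn); last 2 first.
  - by rewrite nnegrE mulr_ge0 // powR_ge0.
  - by rewrite nnegrE.
  rewrite expnMn mulnA mulnA natrM exprMn natrX [X in X <= _]mulrC.
  rewrite ler_wpM2l ?exprn_ge0 // -powR_mulrn ?powR_ge0 // -powRrM.
  rewrite -expnM !natrM -powR2_nat -yn.
  rewrite -[X in X * _ * _](powRr1 (ler0n R 2)) -!powR2D ler_powR2.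
  rewrite natrM; have -> : h.-1%:R = h%:R - 1 :> R by rewrite -[h in RHS]addn1 natrD addrK.
  (* After cancelling n^h the claim on exponents is 1 + y^2 + (h - 1)h <= 2yh, that is (h - y)^2 <=
     h - 1; it holds since 0 <= h - y <= 1 and h >= 2. *)
  move: (h%:R : R) h1 h2 => x h1 h2; nra.
apply: (@solvable_prob_ge _ _ _ _ 1 2) => //; rewrite mul1n.
have := @card_unsolvable_le n h s; rewrite hn /= => /(_ isT).
set U := #|_ :\: _| => Ule.
have DU : #|dists 'I_n s| = (#|solvable_dists (path_graph n) s| + U)%N.
  rewrite -(cardsID (solvable_dists (path_graph n) s) (dists 'I_n s)); congr (_ + _)%N.
  apply: eq_card => D; rewrite !inE.
  by case: (_ == _).
suff : (2 * U <= #|dists 'I_n s|)%N.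
  by rewrite DU mul2n -addnn leq_add2r mul2n -addnn leq_add2l.
rewrite -(@leq_pmul2r (s ^ h)); last by rewrite expn_gt0 s0.
rewrite -mulnA; apply: (@leq_trans (2 * (n * (2 ^ h.-1 * n) ^ h * #|dists 'I_n s|))).
  by rewrite leq_mul2l Ule orbT.
by rewrite mulnA [X in (_ <= X)%N]mulnC leq_mul2r key orbT.
Unshelve. all: by end_near. Qed.

(** A diagonal choice: take g strictly increasing with B k (g k), and let w invert g on its range
    and be large elsewhere. *)
Lemma exists_divergent_frequently (B : nat -> nat -> Prop) :
  (forall k N, exists2 n, (N <= n)%N & B k n) ->
  exists2 w : nat -> nat, (forall M, exists N, forall n, (N <= n)%N -> (M <= w n)%N) &
    forall N, exists2 n, (N <= n)%N & B (w n) n.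
Proof.
move=> freq.
have /choice[f fP] : forall kN : nat * nat, exists n, (kN.2 <= n)%N /\ B kN.1 n.
  by move=> [k N]; have [n] := freq k N; exists n.
pose g := fix g k := f (k, if k is k'.+1 then (g k').+1 else 0%N).
have gS k : (g k < g k.+1)%N by have [] := fP (k.+1, (g k).+1).
have gmono : {mono g : k l / (k <= l)%N}.
  by apply: ssrnat.leq_mono; apply: homo_ltn gS => ? ? ?; apply: ltn_trans.
have gB k : B k (g k) by case: k => [|k]; [have [] := fP (0%N, 0%N) | have [] := fP (k.+1, (g k).+1)].
have gge k : (k <= g k)%N by elim: k => // k /leq_ltn_trans; apply.
(* Off the range of g, [index] returns the length n.+1, so w still diverges there. *)
pose w n := index n (mkseq g n.+1).
exists w => [M|N].
  exists (g M) => n gMn; rewrite leqNgt; apply/negP => wM.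
  have wn : (w n < n.+1)%N by rewrite ltnS (leq_trans (ltnW wM)) // (leq_trans (gge M)).
  have : nth 0%N (mkseq g n.+1) (w n) = n by rewrite nth_index // -index_mem size_mkseq.
  rewrite nth_mkseq // => gn; have := gmono M (w n).
  by rewrite gn gMn leqNgt wM.
exists (g N) => //; suff -> : w (g N) = N by [].
rewrite /w -[X in index X](nth_mkseq 0%N g (gge N : (N < (g N).+1)%N)).
rewrite index_uniq ?size_mkseq ?ltnS //.
by apply: mkseq_uniq; apply: incn_inj.
Qed.

Lemma not_bigO_divergent (R : realType) (f h : R^nat) : ~ (f =O_\oo h) ->
  exists w : nat -> nat, [/\ (w n)%:R @[n --> \oo] --> (+oo : set_system R),
    forall n, (0 < w n)%N &
    forall N, exists2 n, (N <= n)%N & (w n)%:R * `|h n| < `|f n|].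
Proof.
move=> fh; pose B k n := k.+1%:R * `|h n| < `|f n|.
have [k N|w woo wB] := @exists_divergent_frequently B.
  apply: contra_notP fh => nB; apply/eqO_exP; exists k.+1%:R => //.
  exists N => // n /= Nn; rewrite leNgt; apply/negP => Bkn.
  by apply: nB; exists n.
exists (fun n => (w n).+1); split => //.
apply/cvgryPge => A; have [N wN] := woo (Num.truncn A).
exists N => // n /= Nn; apply/ltW/(lt_le_trans (truncnS_gt A)).
by rewrite ler_nat ltnS wN.
Qed.

Lemma round_nat_le (R : realType) (x y : R) :
  0 <= y -> x <= y -> (round_nat x)%:R <= y + 1.
Proof.
move=> y0 xy; have [x0|x0] := leP 0 (x + 2^-1).
  rewrite /round_nat; have /andP[+ _] := truncn_itv x0; lra.
have /truncn0Pn : ~~ (1 <= x + 2^-1) by rewrite -ltNge; lra.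
by rewrite /round_nat => ->; rewrite addr_ge0.
Qed.

Lemma round_nat_ge (R : realType) (x y : R) : y + 1 <= x -> y <= (round_nat x)%:R.
Proof.
move=> yx; rewrite /round_nat; have := truncnS_gt (x + 2^-1).
by rewrite -[X in _ < X]natr1; lra.
Qed.

Theorem theorem4 (R : realType) (t : R^nat) (ht : th path_graph t) :
  (forall c : R, c < 1 / Num.sqrt 2 ->
    t \is 'Omega_\oo (fun n : nat => n%:R * 2 `^ (c * Num.sqrt (lg (n%:R : R))))) /\
  t =O_\oo (fun n : nat => n%:R * 2 `^ (2 * Num.sqrt (lg (n%:R : R)))).
Proof.
split=> [c clt|].
  (* If the bound fails, some w tending to infinity keeps t * w below the target infinitely often,
     where solvability has probability at most 7/8 instead of tending to 1. *)
  rewrite eqOmegaO; apply: contrapT => /not_bigO_divergent[w [woo w0 wt]].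
  have [+ _] := ht _ woo => /cvgr_gt /(_ (7 / 8)) [|N1 _ P1]; first by lra.
  have [N2 _ P2] := near_solvable_prob_le clt.
  have [n /[!geq_max]/andP[/P1 /= n1 /P2 /= n2] wn] := wt (maxn N1 N2).
  suff : solvable_prob R (path_graph n) (round_nat (t n * (w n)%:R)) <= 7 / 8.
    by rewrite leNgt n1.
  apply: n2; apply: round_nat_le; first by rewrite mulr_ge0 // powR_ge0.
  apply: (le_trans (ler_norm _)); rewrite normrM normr_nat mulrC.
  by apply: (le_trans (ltW wn)); rewrite ger0_norm // mulr_ge0 // powR_ge0.
(* At n with t n <= 0 the size t n * n rounds to a value covered by the lower-bound estimate with c
   = 0, against the limit 1. Positivity lets [|t n|] be replaced by t n below. *)
have tpos : \forall n \near \oo, 0 < t n.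
  have noo : (n%:R : R) @[n --> \oo] --> +oo by exact: cvgr_idn.
  have [+ _] := ht _ noo => /cvgr_gt /(_ (7 / 8)) H.
  have c0 : (0 : R) < 1 / Num.sqrt 2 by rewrite divr_gt0 // sqrtr_gt0.
  have {}H := H ltac:(lra).
  near=> n; rewrite ltNge; apply/negP => tn.
  suff : solvable_prob R (path_graph n) (round_nat (t n * n%:R)) <= 7 / 8.
    by rewrite leNgt; apply/negP/negPn; near: n.
  have : forall s : nat, s%:R <= n%:R * 2 `^ (0 * Num.sqrt (lg (n%:R : R))) + 1 ->
      solvable_prob R (path_graph n) s <= 7 / 8.
    by near: n; apply: near_solvable_prob_le.
  apply; apply: round_nat_le; first by rewrite mulr_ge0 // powR_ge0.
  by apply: (@le_trans _ _ 0); rewrite ?mulr_le0_ge0 // mulr_ge0 // powR_ge0.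
apply: contrapT => /not_bigO_divergent[w [woo w0 wt]].
(* Halving w gives t / (w / 2) > 2g >= g + 1 for the target g >= 1, which absorbs the rounding. *)
have w2oo : ((w n)%:R / 2 : R) @[n --> \oo] --> +oo.
  apply/cvgryPge => A; move/cvgryPge: woo => /(_ (A * 2)); apply: filterS => n.
  by rewrite ler_pdivlMr.
have [_ +] := ht _ w2oo => /cvgr_lt /(_ (1 / 2)) [|N1 _ P1]; first by lra.
have [N2 _ P2] := near_solvable_prob_ge R.
have [N3 _ P3] := tpos.
have [n] := wt (maxn (maxn N1 1) (maxn N2 N3)).
rewrite !geq_max => /andP[/andP[/P1 /= n1 n0] /andP[/P2 /= n2 /P3 /= n3]] wn.
suff : 1 / 2 <= solvable_prob R (path_graph n) (round_nat (t n / ((w n)%:R / 2))).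
  by rewrite leNgt n1.
apply: n2; apply: round_nat_ge.
rewrite ler_pdivlMr ?divr_gt0 ?ltr0n //.
move: wn; rewrite (gtr0_norm n3) ger0_norm ?mulr_ge0 ?powR_ge0 //.
set g := n%:R * _ => wn.
have g1 : 1 <= g.
  rewrite /g -[X in X <= _]mulr1 ler_pM ?ler1n //.
  by rewrite -[X in X <= _](powRr0 2) ler_powR2 mulr_ge0 // sqrtr_ge0.
have : 1 <= (w n)%:R :> R by rewrite ler1n.
nra.
Unshelve. all: by end_near. Qed.
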